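(* Let $P=(X,\prec)$ be a finite poset of width two with a fixed partition $X=\mathcal{C}_1\sqcup\mathcal{C}_2$ into chains $\mathcal{C}_1=\{\alpha_1\prec\cdots\prec\alpha_{a}\}$, $\mathcal{C}_2=\{\beta_1\prec\cdots\prec\beta_{b}\}$, and let $x,y\in\mathcal{C}_1$ be distinct. Let $\mathbf{q}=(q_1,\dots,q_a)$ be formal variables and define $$F_{\mathbf{q}}(k):=\sum_{L\in\mathcal{E}(P)\,:\,L(y)-L(x)=k}\mathbf{q}^L.$$ Then $F_{\mathbf{q}}(k)^2\geqslant F_{\mathbf{q}}(k-1)\,F_{\mathbf{q}}(k+1)$ for all $k>1$, where the inequality between polynomials in $q_1,\dots,q_a$ is coefficient-wise.
   Context: $\mathcal{E}(P)$ is the set of linear extensions of $P$, i.e. bijections $L:X\to\{1,\dots,|X|\}$ with $L(u)<L(v)$ whenever $u\prec v$. The multivariate weight of $L$ is $\mathbf{q}^L:=\prod_{i=1}^{a}q_i^{L(\alpha_i)-L(\alpha_{i-1})}$ with the convention $L(\alpha_0):=0$. *)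

(* Defs.v *)
From HB Require Import structures.
From mathcomp Require Export all_boot all_order all_algebra.
From mathcomp Require Export mpoly.

Set Implicit Arguments.
Unset Strict Implicit.
Unset Printing Implicit Defensive.

Import Order.TTheory GRing.Theory Num.Theory.

Section Posets.
Context {d : Order.disp_t} {X : finPOrderType d}.

Definition antichain (A : {set X}) : bool :=
  [forall u in A, forall v in A, (u != v) ==> (u >< v)%O].

Definition width : nat := \max_(A : {set X} | antichain A) #|A|.

(* [L u : 'I_#|X|] is 0-based; the value of the linear extension at [u],
   in {1, ..., |X|}, is [pos L u]. *)
Definition pos (L : {ffun X -> 'I_#|X|}) (u : X) : nat := (L u).+1.

Definition linear_extensions : {set {ffun X -> 'I_#|X|}} :=
  [set L : {ffun X -> 'I_#|X|} |
    [&& injectiveb L,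
        [forall i : 'I_#|X|, exists u : X, L u == i] &
        [forall u : X, forall v : X, (u < v)%O ==> (pos L u < pos L v)%N]]].

Context {a : nat}.

(* The chain is indexed from 0, so [alpha i] is the paper's alpha_{i+1}; this
   is L(alpha_i) in the paper's indexing, with L(alpha_0) := 0. *)
Definition prev_pos (alpha : 'I_a -> X) (L : {ffun X -> 'I_#|X|})
    (i : 'I_a) : nat :=
  if (i : nat) == 0%N then 0%N else pos L (alpha (ord_pred i)).

Local Open Scope ring_scope.

(* The subtraction in the exponent is the truncated one on [nat]; it agrees
   with the integer one when [alpha] is increasing and [L] is a linear
   extension. *)
Definition qweight (alpha : 'I_a -> X) (L : {ffun X -> 'I_#|X|}) :
    {mpoly int[a]} :=
  \prod_(i < a) 'X_i ^+ (pos L (alpha i) - prev_pos alpha L i)%N.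

Definition Fq (alpha : 'I_a -> X) (x y : X) (k : int) : {mpoly int[a]} :=
  \sum_(L in linear_extensions | (pos L y)%:Z - (pos L x)%:Z == k)
    qweight alpha L.

End Posets.

Arguments width {d} X.

Definition mpoly_coef_le {n : nat} (p q : {mpoly int[n]}) : Prop :=
  forall m : 'X_{1..n}, (p@_m <= q@_m)%R.

(* Main.v *)
Require Import Defs.
From HB Require Import structures.
From mathcomp Require Import all_boot all_order all_algebra.
From mathcomp Require Import mpoly.
From mathcomp Require Import zify.
Import Order.TTheory GRing.Theory Num.Theory.

(* A linear extension L is encoded by h(i), the number of betas placed before
   alpha_i: a weakly increasing sequence confined to a box.  The monomial q^L
   records the increments of h, so it is enough to inject the pairs (h, g) with
   h(t) - h(s) = K - 1 and g(t) - g(s) = K + 1 into the pairs with both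
   differences equal to K, without changing h + g.

   Put c = g(s) - h(s) + 1, so that g - h - c is -1 at s and 1 at t.  Tie two
   indices when the pair stops being monotone as soon as (h, g) is replaced by
   (g - c, h + c) at exactly one of them.  The replacement may then be performed
   independently on each block (connected component) without destroying
   monotonicity, and it does not change the blocks.  On a block g - h - c has
   constant sign, so s and t lie in different blocks.  If the box allows it, flip
   the block of t.  Otherwise c < 0, the box allows flipping the block of s, and
   we do this and then exchange h and g.  The two cases are told apart from the
   result by whether the block of t, with the center c read off at s, may be
   flipped; hence the map is injective. *)

(** * Comparing sums through a weight-preserving injection *)

Lemma ler_sum_inj (T : finType) (A B : {set T}) (f : T -> T) (w : T -> int) :
    {in A, forall p, f p \in B} -> {in A &, injective f} ->
    {in A, forall p, w (f p) = w p} -> {in B, forall p, (0 <= w p)%R} ->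
  (\sum_(p in A) w p <= \sum_(p in B) w p)%R.
Proof.
move=> fAB f_inj wf w_ge0.
have sAB : f @: A \subset B by apply/subsetP => _ /imsetP[p pA ->]; exact: fAB.
rewrite [leRHS](big_setID (f @: A)) /= (setIidPr sAB) big_imset //=.
rewrite (eq_bigr w wf) lerDl; apply: sumr_ge0 => p.
by rewrite inE => /andP[_ pB]; exact: w_ge0.
Qed.

(** * Pairs of monotone integer maps in a box, and the balancing injection *)

Section IntegerPoints.
Local Open Scope ring_scope.
Context {I : finType} (R : rel I) (lo hi : I -> int).
Implicit Types (h g : {ffun I -> int}) (p : {ffun I -> int} * {ffun I -> int}).

Definition box_monotone h :=
  [forall i, lo i <= h i <= hi i] &&
  [forall i, forall j, R i j ==> (h i <= h j)].

Lemma box_monotoneP h :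
  reflect ((forall i, lo i <= h i <= hi i) /\ (forall i j, R i j -> h i <= h j))
          (box_monotone h).
Proof.
apply: (iffP andP) => -[hb hm]; split.
- exact/forallP.
- by move=> i j; move/forallP/(_ i)/forallP/(_ j)/implyP: hm.
- exact/forallP.
- by apply/forallP => i; apply/forallP => j; apply/implyP; exact: hm.
Qed.

(** Both of [p.1 i], [p.2 i - c] are at most both of [p.1 j], [p.2 j - c]: the pair stays monotone
    for each of the four choices of flipping at [i] and at [j]. *)
Definition crossable (c : int) p (i j : I) :=
  [&& p.1 i <= p.1 j, p.2 i <= p.2 j, p.1 i + c <= p.2 j & p.2 i <= p.1 j + c].

Definition tied c p : rel I := fun i j =>
  (R i j && ~~ crossable c p i j) || (R j i && ~~ crossable c p j i).

Definition block c p (r i : I) := connect (tied c p) r i.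

Definition flip c p (r : I) : {ffun I -> int} * {ffun I -> int} :=
  ([ffun i => if block c p r i then p.2 i - c else p.1 i],
   [ffun i => if block c p r i then p.1 i + c else p.2 i]).

Definition swap p := (p.2, p.1).

Lemma swapK p : swap (swap p) = p.
Proof. by case: p. Qed.

Lemma tied_sym c p : connect_sym (tied c p).
Proof. by apply: sym_connect_sym => i j; rewrite /tied orbC. Qed.

(** A flip at [i] only exchanges [p.1 i] with [p.2 i - c], and [crossable] is symmetric in these two
    values. *)
Lemma block_flip c p r : block c (flip c p r) =2 block c p.
Proof.
move=> q i; apply: eq_connect => {q} {}i j; rewrite /tied.
suff E u v : crossable c (flip c p r) u v = crossable c p u v by rewrite !E.
rewrite /crossable /flip /= !ffunE; case: ifP => _; case: ifP => _; lia.
Qed.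

Lemma block_swap c p : block (- c) (swap p) =2 block c p.
Proof.
move=> q i; apply: eq_connect => {q} {}i j; rewrite /tied.
suff E u v : crossable (- c) (swap p) u v = crossable c p u v by rewrite !E.
rewrite /crossable /swap /=; lia.
Qed.

Lemma flipK c p r : flip c (flip c p r) r = p.
Proof.
rewrite [LHS]surjective_pairing [RHS]surjective_pairing.
by congr pair; apply/ffunP => i; rewrite !ffunE block_flip;
  case: (block _ _ _ _) => //; rewrite ?addrK ?subrK.
Qed.

Lemma flip_sum c p r i : (flip c p r).1 i + (flip c p r).2 i = p.1 i + p.2 i.
Proof. by rewrite !ffunE; case: ifP => _ //; rewrite addrC; lia. Qed.

(** A crossable pair survives any choice of flips; a related pair that is not crossable is tied, so
    its two ends are flipped together or not at all. *)
Lemma flip_monotone c p r :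
    (forall i j, R i j -> p.1 i <= p.1 j /\ p.2 i <= p.2 j) ->
  forall i j, R i j ->
  (flip c p r).1 i <= (flip c p r).1 j /\ (flip c p r).2 i <= (flip c p r).2 j.
Proof.
move=> pm i j Rij; have [h1 h2] := pm _ _ Rij.
have [Cij|nCij] := boolP (crossable c p i j).
  by move: Cij; rewrite /crossable !ffunE => /and4P[*];
     case: ifP => _; case: ifP => _; split; lia.
rewrite /flip /= !ffunE.
have -> : block c p r i = block c p r j.
  apply: (same_connect_r (tied_sym c p)); apply: connect1.
  by rewrite /tied Rij nCij.
by case: ifP => _; split; lia.
Qed.

(* A monotone pair whose difference [p.2 - p.1 - c] changes sign between [i]
   and [j] is crossable there. *)
Lemma block_sign c p r i :
    (forall i j, R i j -> p.1 i <= p.1 j /\ p.2 i <= p.2 j) ->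
    block c p r i ->
  (p.1 r + c < p.2 r) = (p.1 i + c < p.2 i) /\
  (p.2 r < p.1 r + c) = (p.2 i < p.1 i + c).
Proof.
move=> pm b.
have E (u v : I) : R u v -> ~~ crossable c p u v ->
    (p.1 u + c < p.2 u) = (p.1 v + c < p.2 v) /\
    (p.2 u < p.1 u + c) = (p.2 v < p.1 v + c).
  by move=> /pm[]; rewrite /crossable; lia.
split.
  apply: (closed_connect (a := [pred i | p.1 i + c < p.2 i]) _ b) => u v.
  by case/orP => /andP[/E e /e[]].
apply: (closed_connect (a := [pred i | p.2 i < p.1 i + c]) _ b) => u v.
by case/orP => /andP[/E e /e[]].
Qed.

Context (s t : I).

Definition center p := p.2 s - p.1 s + 1.

Definition flippable c p := [forall i, block c p t i ==>
  (lo i <= p.2 i - c <= hi i) && (lo i <= p.1 i + c <= hi i)].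

Definition balance p :=
  let c := center p in
  if flippable c p then flip c p t else swap (flip c p s).

(** Left inverse of [balance], with center and branch read off the result. In the second branch the
    swap has negated the center, hence the flip by [- c]. *)
Definition unbalance p :=
  let c := center p in
  if flippable c p then flip c p t else flip (- c) (swap p) s.

Lemma balance_sum p i : (balance p).1 i + (balance p).2 i = p.1 i + p.2 i.
Proof.
rewrite /balance; case: ifP => _; first exact: flip_sum.
by rewrite /swap [LHS]addrC; exact: flip_sum.
Qed.

Section Balance.
Variable p : {ffun I -> int} * {ffun I -> int}.
Hypotheses (box1 : box_monotone p.1) (box2 : box_monotone p.2).
Hypothesis gap : p.2 t - p.1 t = p.2 s - p.1 s + 2.
Let c := center p.

Let pm i j : R i j -> p.1 i <= p.1 j /\ p.2 i <= p.2 j.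
Proof.
by case/box_monotoneP: box1 => _ m1; case/box_monotoneP: box2 => _ m2 Rij; split; auto.
Qed.

Lemma block_disjoint i : block c p t i -> block c p s i = false.
Proof.
move=> bt; apply/negP => bs.
have [] := block_sign c p t i pm bt; have [] := block_sign c p s i pm bs.
by move: gap; rewrite /c /center; lia.
Qed.

Lemma block_st : block c p s t = false.
Proof. by apply: block_disjoint; exact: connect0. Qed.

Lemma block_ts : block c p t s = false.
Proof.
apply/negP => b; have := block_disjoint _ b.
by rewrite /block connect0.
Qed.

Lemma box_flip r :
    (forall i, block c p r i ->
       (lo i <= p.2 i - c <= hi i) && (lo i <= p.1 i + c <= hi i)) ->
  box_monotone (flip c p r).1 /\ box_monotone (flip c p r).2.
Proof.
move=> ok; have fm := flip_monotone c p r pm.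
case/box_monotoneP: box1 => b1 _; case/box_monotoneP: box2 => b2 _.
by split; apply/box_monotoneP; split=> [i|i j /fm[]//];
  rewrite ffunE; case: ifP => // /ok/andP[].
Qed.

Lemma box_balance :
  box_monotone (balance p).1 /\ box_monotone (balance p).2.
Proof.
rewrite /balance -/c; case: ifP => [/forallP fl|nfl].
  by apply: box_flip => i bi; have := fl i; rewrite bi.
suff /box_flip[] : forall i, block c p s i ->
  (lo i <= p.2 i - c <= hi i) && (lo i <= p.1 i + c <= hi i) by [].
(* If [0 <= c], then [p.1 i + c < p.2 i] on the block of [t] puts both new values between [p.1 i]
   and [p.2 i], hence in the box, so that block was flippable. If [c < 0], the opposite inequality
   does the same on the block of [s]. *)
have [c_ge0|c_lt0] := leP 0 c.
  case/negP: (negbT nfl); apply/forallP => i; apply/implyP => b.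
  have [] := block_sign c p t i pm b.
  case/box_monotoneP: box1 => /(_ i) b1 _; case/box_monotoneP: box2 => /(_ i) b2 _.
  by move: gap c_ge0 b1 b2; rewrite /c /center; lia.
move=> i b; have [] := block_sign c p s i pm b.
case/box_monotoneP: box1 => /(_ i) b1 _; case/box_monotoneP: box2 => /(_ i) b2 _.
by move: gap c_lt0 b1 b2; rewrite /c /center; lia.
Qed.

(** As [p.2 - p.1 - c] is 1 at [t] and -1 at [s], flipping at [t] raises [p.1 t] by 1, and flipping
    at [s] lowers [p.1 s] by 1, with the opposite change in [p.2]. Either one makes the two
    differences, initially 2 apart, equal. *)
Lemma balance_gap :
  (balance p).1 t - (balance p).1 s = p.1 t - p.1 s + 1 /\
  (balance p).2 t - (balance p).2 s = p.1 t - p.1 s + 1.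
Proof.
rewrite /balance -/c; case: ifP => _; rewrite /= !ffunE.
  by rewrite block_ts /block connect0; move: gap; rewrite /c /center; lia.
by rewrite block_st /block connect0; move: gap; rewrite /c /center; lia.
Qed.

Lemma balanceK : unbalance (balance p) = p.
Proof.
case/box_monotoneP: (box1) => b1 _; case/box_monotoneP: (box2) => b2 _.
rewrite /balance -/c; case: ifP => fl; rewrite /unbalance.
  (* The block of [t] avoids [s], so the center is unchanged; the test succeeds because flipping
     back returns values of [p]. *)
  have -> : center (flip c p t) = c by rewrite /center !ffunE block_ts.
  rewrite ifT ?flipK //; apply/forallP => i; apply/implyP.
  by rewrite block_flip !ffunE => ->; rewrite addrK subrK b1 b2.
have -> : center (swap (flip c p s)) = - c.
  by rewrite /center /= !ffunE /block connect0 /c /center; lia.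
rewrite ifF.
  by rewrite opprK swapK flipK.
(* The block of [t] was not touched by the flip at [s]; swapping and negating the center only
   exchange the two bounds tested there. *)
rewrite -fl; apply: eq_forallb => i.
rewrite block_swap block_flip; case b: (block c p t i) => //=.
by rewrite !ffunE block_disjoint //= opprK andbC.
Qed.

End Balance.

End IntegerPoints.

(** * Initial segments of ordinals, and linear extensions obtained by ranking keys *)

Lemma card_ord_lt (n m : nat) : (m <= n)%N -> #|[set i : 'I_n | (i < m)%N]| = m.
Proof.
move=> le_mn; rewrite cardsE -sum1_card (big_ord_narrow le_mn) /=.
by rewrite sum1_card card_ord.
Qed.

(** A down-closed set of ordinals is an initial segment, whose length is its cardinal. *)
Lemma ltn_card_downset (n : nat) (Q : pred 'I_n) (j : 'I_n) :
    (forall i i' : 'I_n, (i < i')%N -> Q i' -> Q i) ->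
  (j < #|[set i | Q i]|)%N = Q j.
Proof.
move=> Qdown; case Qj: (Q j).
  rewrite -(card_ord_lt n j.+1) // subset_leq_card //; apply/subsetP => i.
  rewrite !inE ltnS leq_eqVlt => /orP[/eqP/val_inj -> //|ij].
  exact: Qdown Qj.
apply/negbTE; rewrite -leqNgt -[leqRHS](card_ord_lt n j (ltnW (ltn_ord j))).
apply: subset_leq_card; apply/subsetP => i; rewrite !inE ltnNge => Qi.
apply/negP; rewrite leq_eqVlt => /orP[/eqP/val_inj ji|ji].
  by rewrite ji Qi in Qj.
by rewrite (Qdown _ _ ji Qi) in Qj.
Qed.

Section Rank.
Context {d : Order.disp_t} {X : finPOrderType d}.
Implicit Types (key : X -> nat) (L : {ffun X -> 'I_#|X|}).

Lemma rank_proof key (u : X) : (#|[set v | key v < key u]| < #|X|)%N.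
Proof.
rewrite -cardsT; apply: proper_card; rewrite properE subsetT /=.
by apply/subsetPn; exists u; rewrite ?inE ?ltnn.
Qed.

Definition rank key : {ffun X -> 'I_#|X|} :=
  [ffun u => Ordinal (rank_proof key u)].

Lemma ltn_rank key u v : (rank key u < rank key v)%N = (key u < key v)%N.
Proof.
rewrite !ffunE /=; have [uv|vu] := ltnP (key u) (key v).
  apply: proper_card; apply/properP; split.
    by apply/subsetP => w; rewrite !inE => /ltn_trans; apply.
  by exists u; rewrite ?inE ?ltnn.
apply/negbTE; rewrite -leqNgt subset_leq_card //.
by apply/subsetP => w; rewrite !inE => /leq_trans; apply.
Qed.

Lemma eq_rank key1 key2 :
    (forall u v, (key1 u < key1 v)%N = (key2 u < key2 v)%N) ->
  rank key1 = rank key2.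
Proof.
move=> E; apply/ffunP => u; apply: val_inj; rewrite !ffunE /=.
by apply: eq_card => v; rewrite !inE E.
Qed.

Lemma linextP L : L \in linear_extensions ->
  injective L /\ forall u v, (u < v)%O -> (L u < L v)%N.
Proof.
rewrite inE => /and3P[/injectiveP Linj _ /forallP Lm]; split=> // u v.
by move/forallP/(_ v)/implyP: (Lm u).
Qed.

Lemma rank_linext key :
    injective key -> (forall u v, (u < v)%O -> (key u < key v)%N) ->
  rank key \in linear_extensions.
Proof.
move=> key_inj key_mono.
have r_inj : injective (rank key).
  move=> u v uv; apply: key_inj.
  by case: (ltngtP (key u) (key v)) => //; rewrite -(ltn_rank key) uv ltnn.
rewrite inE; apply/and3P; split; first exact/injectiveP.
- have [g _ gK] : bijective (rank key).
    by apply: inj_card_bij => //; rewrite card_ord.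
  by apply/forallP => i; apply/existsP; exists (g i); rewrite gK.
- apply/forallP => u; apply/forallP => v; apply/implyP => uv.
  by rewrite ltnS ltn_rank key_mono.
Qed.

Lemma rank_id L : L \in linear_extensions -> rank (fun u => L u) = L.
Proof.
case/linextP => Linj _.
have [g gK Kg] : bijective L by apply: inj_card_bij => //; rewrite card_ord.
apply/ffunP => u; apply: val_inj; rewrite !ffunE /=.
rewrite -[RHS](card_ord_lt _ _ (ltnW (ltn_ord (L u)))).
rewrite -(card_imset _ Linj); apply: eq_card => i; rewrite inE.
apply/imsetP/idP => [[v]|iu]; first by rewrite inE => ? ->.
by exists (g i); rewrite ?inE Kg.
Qed.

End Rank.

(** * Linear extensions of two chains as monotone lattice paths *)

Section TwoChains.
Context {d : Order.disp_t} {X : finPOrderType d} {a b : nat}.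
Context (alpha : 'I_a -> X) (beta : 'I_b -> X).
Hypothesis halpha : forall i j : 'I_a, (i < j)%N -> (alpha i < alpha j)%O.
Hypothesis hbeta : forall i j : 'I_b, (i < j)%N -> (beta i < beta j)%O.
Hypothesis hcover : forall u, (exists i, u = alpha i) \/ (exists j, u = beta j).
Hypothesis hdisj : forall i j, alpha i <> beta j.
Implicit Type L : {ffun X -> 'I_#|X|}.

Lemma lt_chain (n : nat) (f : 'I_n -> X) :
    (forall i j : 'I_n, (i < j)%N -> (f i < f j)%O) ->
  forall i j, (f i < f j)%O = (i < j)%N.
Proof.
move=> fm i j; have [/fm//|] := ltnP i j.
rewrite leq_eqVlt => /orP[/eqP/val_inj->|/fm/ltW]; first by rewrite ltxx.
by move/le_gtF.
Qed.

Lemma chain_inj (n : nat) (f : 'I_n -> X) :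
  (forall i j : 'I_n, (i < j)%N -> (f i < f j)%O) -> injective f.
Proof.
move=> fm i j fij; apply: val_inj.
by case: (ltngtP (val i) (val j)) => //; rewrite -(lt_chain _ _ fm) fij ltxx.
Qed.

Lemma ltn_linext_chain L (n : nat) (f : 'I_n -> X) :
    L \in linear_extensions ->
    (forall i j : 'I_n, (i < j)%N -> (f i < f j)%O) ->
  forall i j, (L (f i) < L (f j))%N = (i < j)%N.
Proof.
move=> /linextP[_ Lm] fm i j; have [/fm/Lm//|] := ltnP i j.
rewrite leq_eqVlt => /orP[/eqP/val_inj->|/fm/Lm/ltnW]; first by rewrite ltnn.
by rewrite leqNgt => /negbTE.
Qed.

Lemma card_two_chains (P : pred X) :
  #|[set u | P u]| = (#|[set i | P (alpha i)]| + #|[set j | P (beta j)]|)%N.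
Proof.
rewrite -(card_imset _ (chain_inj _ _ halpha)) -(card_imset _ (chain_inj _ _ hbeta)).
set A := _ @: _; set B := _ @: _.
have AB0 : A :&: B = set0.
  apply/setP => u; rewrite !inE; apply/negP => /andP[/imsetP[i _ ->]].
  by case/imsetP => j _; exact: hdisj.
rewrite -cardsUI AB0 cards0 addn0; apply: eq_card => u; rewrite !inE.
apply/idP/orP => [Pu|[]/imsetP[i]]; last 2 first.
- by rewrite inE => ? ->.
- by rewrite inE => ? ->.
by case: (hcover u) => -[i ui]; [left|right]; apply/imsetP; exists i;
  rewrite ?inE -?ui.
Qed.

(* [below L] records the lattice path of [L]: at [i], the number of elements of
   the chain [beta] placed before [alpha i]. *)
Definition below L : {ffun 'I_a -> int} :=
  [ffun i => Posz #|[set j | (L (beta j) < L (alpha i))%N]|].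

(** The relations between the two chains enter the encoding only through these bounds: the betas
    forced before [alpha i], and those not forced after it. *)
Definition path_lo (i : 'I_a) : int := Posz #|[set j | (beta j < alpha i)%O]|.
Definition path_hi (i : 'I_a) : int := Posz #|[set j | ~~ (alpha i < beta j)%O]|.

Local Notation admissible := (box_monotone (fun i j : 'I_a => (i < j)%N) path_lo path_hi).

(** Counted from 0, a position is the number of elements placed earlier; before [alpha i] these are
    [i] alphas and [below L i] betas. *)
Lemma linext_alpha L i : L \in linear_extensions ->
  Posz (L (alpha i)) = (Posz i + below L i)%R.
Proof.
move=> LE; rewrite ffunE -PoszD; congr Posz.
rewrite -{1}(rank_id L LE) ffunE /= card_two_chains; congr (_ + _)%N.
rewrite -[RHS](card_ord_lt _ _ (ltnW (ltn_ord i))); apply: eq_card => i'.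
by rewrite !inE (ltn_linext_chain _ _ _ LE halpha).
Qed.

Lemma ltn_linext_beta_alpha L i j : L \in linear_extensions ->
  (L (beta j) < L (alpha i))%N = (Posz j < below L i)%R.
Proof.
move=> LE; rewrite ffunE ltz_nat ltn_card_downset // => j1 j2 j12.
by apply: ltn_trans; rewrite (ltn_linext_chain _ _ _ LE hbeta).
Qed.

Lemma below_admissible L : L \in linear_extensions -> admissible (below L).
Proof.
move=> LE; have [Linj Lm] := linextP L LE.
apply/box_monotoneP; split=> [i|i i' ii']; rewrite !ffunE ?lez_nat.
  apply/andP; split; apply/subset_leq_card/subsetP => j; rewrite !inE.
    exact: Lm.
  by move=> ji; apply/negP => /Lm; rewrite ltnNge ltnW.
apply/subset_leq_card/subsetP => j; rewrite !inE => /ltn_trans; apply.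
by rewrite (ltn_linext_chain _ _ _ LE halpha).
Qed.

(* [alpha i] precedes [beta j] iff [h i <= j]: keys are pairs (position on the
   beta side, position among the alphas) in base [a.+1], and [beta j] comes
   after every [alpha i] with [h i = j]. *)
Definition path_key (h : {ffun 'I_a -> int}) (u : X) : nat :=
  if [pick i | alpha i == u] is Some i then `|h i|%N * a.+1 + i
  else if [pick j | beta j == u] is Some j then j * a.+1 + a else 0.

Lemma path_key_alpha h i : path_key h (alpha i) = (`|h i|%N * a.+1 + i)%N.
Proof.
rewrite /path_key; case: pickP => [i' /eqP/(chain_inj _ _ halpha)-> //|/(_ i)].
by rewrite eqxx.
Qed.

Lemma path_key_beta h j : path_key h (beta j) = (j * a.+1 + a)%N.
Proof.
rewrite /path_key; case: pickP => [i' /eqP/hdisj //|_].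
case: pickP => [j' /eqP/(chain_inj _ _ hbeta)-> //|/(_ j)].
by rewrite eqxx.
Qed.

Definition linext_of_path h : {ffun X -> 'I_#|X|} := rank (path_key h).

Section Path.
Variable h : {ffun 'I_a -> int}.
Hypothesis adm : admissible h.

Let h_ge0 i : (0 <= h i)%R.
Proof. by case/box_monotoneP: adm => /(_ i)/andP[+ _] _; apply: le_trans. Qed.

Lemma ltn_path_key_alpha i i' :
  (path_key h (alpha i) < path_key h (alpha i'))%N = (i < i')%N.
Proof.
have H (i1 i2 : 'I_a) : (i1 < i2)%N ->
    (path_key h (alpha i1) < path_key h (alpha i2))%N.
  move=> i12; case/box_monotoneP: adm => _ /(_ _ _ i12) h12.
  rewrite !path_key_alpha -addnS leq_add // leq_mul2r.
  by move: (h i1) (h i2) h12 (h_ge0 i1) => x y; lia.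
have [/H//|] := ltnP i i'.
rewrite leq_eqVlt => /orP[/eqP/val_inj->|/H/ltnW]; first by rewrite ltnn.
by rewrite leqNgt => /negbTE.
Qed.

Lemma ltn_path_key_beta j j' :
  (path_key h (beta j) < path_key h (beta j'))%N = (j < j')%N.
Proof. by rewrite !path_key_beta ltn_add2r ltn_pmul2r. Qed.

Lemma ltn_path_key_beta_alpha j i :
  (path_key h (beta j) < path_key h (alpha i))%N = (Posz j < h i)%R.
Proof.
rewrite path_key_alpha path_key_beta; have := ltn_ord i; have := h_ge0 i.
by move: (h i) (nat_of_ord i) (nat_of_ord j) => [] // m {}i {}j _ ia /=; nia.
Qed.

Lemma ltn_path_key_alpha_beta i j :
  (path_key h (alpha i) < path_key h (beta j))%N = (h i <= Posz j)%R.
Proof.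
rewrite path_key_alpha path_key_beta; have := ltn_ord i; have := h_ge0 i.
by move: (h i) (nat_of_ord i) (nat_of_ord j) => [] // m {}i {}j _ ia /=; nia.
Qed.

Lemma path_key_inj : injective (path_key h).
Proof.
move=> u v uv.
have [] : (path_key h u < path_key h v)%N = false /\
          (path_key h v < path_key h u)%N = false by rewrite uv ltnn.
move: (hcover u) (hcover v) => [] [i ->] [] [j ->];
  rewrite ?(ltn_path_key_alpha, ltn_path_key_beta, ltn_path_key_beta_alpha,
            ltn_path_key_alpha_beta); try lia.
- by move=> ij ji; congr alpha; apply: val_inj => /=; lia.
- by move=> ij ji; congr beta; apply: val_inj => /=; lia.
Qed.

Lemma path_key_mono u v : (u < v)%O -> (path_key h u < path_key h v)%N.
Proof.
case/box_monotoneP: adm => box _.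
move: (hcover u) (hcover v) => [] [i ->] [] [j ->].
- by rewrite (lt_chain _ _ halpha) ltn_path_key_alpha.
- move=> ij; rewrite ltn_path_key_alpha_beta.
  have /andP[_ /le_trans] := box i; apply; rewrite lez_nat leqNgt.
  rewrite (ltn_card_downset _ (fun j => ~~ (alpha i < beta j)%O)) ?ij //.
  by move=> j1 j2 /hbeta j12; apply: contra => /lt_trans; apply.
- move=> ji; rewrite ltn_path_key_beta_alpha.
  have /andP[+ _] := box j; apply: lt_le_trans; rewrite ltz_nat.
  rewrite (ltn_card_downset _ (fun k => (beta k < alpha j)%O)) //.
  by move=> j1 j2 /hbeta j12; apply: lt_trans.
- by rewrite (lt_chain _ _ hbeta) ltn_path_key_beta.
Qed.

Lemma linext_of_pathP : linext_of_path h \in linear_extensions.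
Proof. exact: rank_linext path_key_inj path_key_mono. Qed.

Lemma linext_of_pathK : below (linext_of_path h) = h.
Proof.
apply/ffunP => i; rewrite ffunE.
(* With this bound, exactly [h i] indices [j] in ['I_b] lie below [h i]. *)
have hb : (`|h i| <= b)%N.
  case/box_monotoneP: adm => /(_ i)/andP[_ hi_i] _.
  have : (#|[set j | ~~ (alpha i < beta j)%O]| <= b)%N.
    by rewrite -[leqRHS]card_ord max_card.
  by move: (h i) hi_i (h_ge0 i); rewrite /path_hi => z; lia.
transitivity (Posz `|h i|%N); last by rewrite gez0_abs.
congr Posz; rewrite -[RHS](card_ord_lt b) //; apply: eq_card => j.
rewrite !inE ltn_rank ltn_path_key_beta_alpha.
by move: (h i) (h_ge0 i) => z; lia.
Qed.

End Path.

(** A rank depends only on how keys compare, so it suffices that [path_key (below L)] and [L] order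
    elements alike, for each choice of their chains. *)
Lemma belowK L : L \in linear_extensions -> linext_of_path (below L) = L.
Proof.
move=> LE; rewrite -[RHS](rank_id L LE); apply: eq_rank => u v.
have adm := below_admissible L LE; have [Linj _] := linextP L LE.
move: (hcover u) (hcover v) => [] [i ->] [] [j ->].
- by rewrite ltn_path_key_alpha // (ltn_linext_chain _ _ _ LE halpha).
- rewrite ltn_path_key_alpha_beta // leNgt -ltn_linext_beta_alpha // -leqNgt.
  by rewrite leq_eqVlt orb_idl // => /eqP/val_inj/Linj/hdisj.
- by rewrite ltn_path_key_beta_alpha // ltn_linext_beta_alpha.
- by rewrite ltn_path_key_beta // (ltn_linext_chain _ _ _ LE hbeta).
Qed.

Lemma qweight_mul_eq L1 L2 L1' L2' :
    L1 \in linear_extensions -> L2 \in linear_extensions ->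
    L1' \in linear_extensions -> L2' \in linear_extensions ->
    (forall i, below L1 i + below L2 i = below L1' i + below L2' i)%R ->
  (qweight alpha L1 * qweight alpha L2 = qweight alpha L1' * qweight alpha L2')%R.
Proof.
move=> LE1 LE2 LE1' LE2' E; rewrite /qweight -!big_split /=.
apply: eq_bigr => i _; rewrite -!exprD; congr (_ ^+ _)%R.
(* This makes the truncated subtractions exact, so only sums of positions matter. *)
have step L : L \in linear_extensions ->
    (prev_pos alpha L i <= pos L (alpha i))%N.
  rewrite /prev_pos /pos => LE; case: eqP => // i_neq0; apply: leqW.
  rewrite (ltn_linext_chain _ _ _ LE halpha) /=.
  (* [ord_pred] is cyclic; for [i] nonzero it is the usual predecessor. *)
  have ia := ltn_ord i; have -> : ((i + a).-1 = i.-1 + a)%N by lia.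
  by rewrite modnDr modn_small; lia.
have sum_pos j : (pos L1 (alpha j) + pos L2 (alpha j) =
    pos L1' (alpha j) + pos L2' (alpha j))%N.
  have := E j; have := linext_alpha L1 j LE1; have := linext_alpha L2 j LE2.
  have := linext_alpha L1' j LE1'; have := linext_alpha L2' j LE2'.
  by rewrite /pos; lia.
have sum_prev : (prev_pos alpha L1 i + prev_pos alpha L2 i =
    prev_pos alpha L1' i + prev_pos alpha L2' i)%N.
  by rewrite /prev_pos; case: eqP.
have := sum_pos i; move: (step _ LE1) (step _ LE2) (step _ LE1') (step _ LE2').
by lia.
Qed.

Definition balance_linexts (s t : 'I_a)
    (p : {ffun X -> 'I_#|X|} * {ffun X -> 'I_#|X|}) :=
  let q := balance (fun i j : 'I_a => (i < j)%N) path_lo path_hi s t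
             (below p.1, below p.2) in
  (linext_of_path q.1, linext_of_path q.2).

End TwoChains.

(** * Nonnegative coefficients, and the final inequality *)

Lemma mcoeff_qweight_mul_ge0 (d : Order.disp_t) (X : finPOrderType d) (a : nat)
    (alpha : 'I_a -> X) (L1 L2 : {ffun X -> 'I_#|X|}) (m : 'X_{1..a}) :
  (0 <= (qweight alpha L1 * qweight alpha L2)@_m)%R.
Proof.
have qweightE L : qweight alpha L =
    'X_[[multinom (pos L (alpha i) - prev_pos alpha L i)%N | i < a]].
  by rewrite mpolyXE_id; apply: eq_bigr => i _; rewrite mnmE.
by rewrite !qweightE -mpolyXD mcoeffX.
Qed.

Theorem theorem7p2 (d : Order.disp_t) (X : finPOrderType d)
    (hwidth : width X = 2)
    (a b : nat) (alpha : 'I_a -> X) (beta : 'I_b -> X)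
    (C1 C2 : {set X})
    (halpha : forall i j : 'I_a, (i < j)%N -> (alpha i < alpha j)%O)
    (hbeta : forall i j : 'I_b, (i < j)%N -> (beta i < beta j)%O)
    (hC1 : C1 = [set alpha i | i : 'I_a])
    (hC2 : C2 = [set beta i | i : 'I_b])
    (hcover : C1 :|: C2 = [set: X])
    (hdisj : [disjoint C1 & C2])
    (x y : X) (hx : x \in C1) (hy : y \in C1) (hxy : x <> y)
    (k : int) (hk : (1 < k)%R) :
  mpoly_coef_le (Fq alpha x y (k - 1) * Fq alpha x y (k + 1))%R
                (Fq alpha x y k ^+ 2)%R.
Proof.
have cover u : (exists i, u = alpha i) \/ (exists j, u = beta j).
  have : u \in C1 :|: C2 by rewrite hcover inE.
  by rewrite hC1 hC2 => /setUP[]/imsetP[i _ ->]; [left|right]; exists i.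
have disj i j : alpha i <> beta j.
  move=> ij; have : alpha i \in C1 by rewrite hC1 imset_f.
  by move=> /(disjointFr hdisj); rewrite ij hC2 imset_f.
have inC1 u : u \in C1 -> exists i : 'I_a, u = alpha i.
  by rewrite hC1 => /imsetP[i _ ->]; exists i.
have [[s xs] [t yt]] := (inC1 _ hx, inC1 _ hy) => m.
rewrite expr2 xs yt /Fq !big_distrlr /= !pair_big /= !raddf_sum /=.
(* Expanding the products turns both coefficients into sums over pairs of linear extensions. *)
pose A (k1 k2 : int) := [set p : {ffun X -> 'I_#|X|} * {ffun X -> 'I_#|X|} |
  ((p.1 \in linear_extensions) &&
     ((pos p.1 (alpha t))%:Z - (pos p.1 (alpha s))%:Z == k1)%R) &&
  ((p.2 \in linear_extensions) &&
     ((pos p.2 (alpha t))%:Z - (pos p.2 (alpha s))%:Z == k2)%R)].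
rewrite [leLHS](eq_bigl (fun p => p \in A (k - 1)%R (k + 1)%R)); last by move=> p; rewrite !inE.
rewrite [leRHS](eq_bigl (fun p => p \in A k k)); last by move=> p; rewrite !inE.
have adm := below_admissible alpha beta halpha.
(* Position gaps and path gaps differ by the constant [t - s], so the values [k - 1] and [k + 1]
   give path gaps 2 apart, as balancing requires. *)
have pos_gap L : L \in linear_extensions ->
    (Posz (pos L (alpha t)) - Posz (pos L (alpha s)) =
     below alpha beta L t - below alpha beta L s + (Posz t - Posz s))%R.
  move=> LE; have E := linext_alpha alpha beta halpha hbeta cover disj L ^~ LE.
  by have := E t; have := E s; rewrite /pos; lia.
have gapP p : p \in A (k - 1)%R (k + 1)%R ->
    [/\ p.1 \in linear_extensions, p.2 \in linear_extensions,
     (below alpha beta p.1 t - below alpha beta p.1 s = k - 1 - Posz t + Posz s)%R &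
     (below alpha beta p.2 t - below alpha beta p.2 s = k + 1 - Posz t + Posz s)%R].
  rewrite inE => /andP[/andP[LE1 /eqP e1] /andP[LE2 /eqP e2]]; split=> //.
    by apply: (addIr (Posz t - Posz s)%R); rewrite -pos_gap // e1; lia.
  by apply: (addIr (Posz t - Posz s)%R); rewrite -pos_gap // e2; lia.
have balP p : p \in A (k - 1)%R (k + 1)%R ->
  let R := fun i j : 'I_a => (i < j)%N in
  let q0 := (below alpha beta p.1, below alpha beta p.2) in
  let q := balance R (path_lo alpha beta) (path_hi alpha beta) s t q0 in
  [/\ box_monotone R (path_lo alpha beta) (path_hi alpha beta) q.1,
      box_monotone R (path_lo alpha beta) (path_hi alpha beta) q.2,
      (q.1 t - q.1 s = k - Posz t + Posz s)%R,
      (q.2 t - q.2 s = k - Posz t + Posz s)%R &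
      unbalance R (path_lo alpha beta) (path_hi alpha beta) s t q = q0].
  move=> /gapP[LE1 LE2 e1 e2] R q0 q.
  have gap : (q0.2 t - q0.1 t = q0.2 s - q0.1 s + 2)%R.
    move: e1 e2; rewrite /q0 /=; move: (below _ _ p.1 t) (below _ _ p.1 s).
    by move: (below _ _ p.2 t) (below _ _ p.2 s); lia.
  have [b1 b2] := box_balance R _ _ s t q0 (adm _ LE1) (adm _ LE2) gap.
  have [g1 g2] := balance_gap R _ _ s t q0 (adm _ LE1) (adm _ LE2) gap.
  split=> //; [rewrite g1 e1; lia|rewrite g2 e1; lia|].
  exact: (balanceK R _ _ s t q0 (adm _ LE1) (adm _ LE2) gap).
have pathK := linext_of_pathK alpha beta halpha hbeta disj.
have pathP := linext_of_pathP alpha beta halpha hbeta cover disj.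
apply: (ler_sum_inj _ _ _ (balance_linexts alpha beta s t)).
- move=> p /balP[b1 b2 g1 g2 _]; rewrite inE !pathP //= !pos_gap ?pathP //.
  by rewrite !pathK // g1 g2; apply/andP; split; apply/eqP; lia.
(* Equal images have equal balanced paths; [unbalance] recovers the original paths, and [belowK] the
   extensions. *)
- move=> p p' pA p'A [E1 E2].
  have [b1 b2 _ _ K] := balP _ pA; have [b1' b2' _ _ K'] := balP _ p'A.
  have [LE1 LE2 _ _] := gapP _ pA; have [LE1' LE2' _ _] := gapP _ p'A.
  have := congr1 (below alpha beta) E1; have := congr1 (below alpha beta) E2.
  rewrite !pathK // => F2 F1.
  move: K K'; rewrite [X in unbalance _ _ _ _ _ X]surjective_pairing F1 F2.
  rewrite -surjective_pairing => -> [H1 H2].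
  have belK := belowK alpha beta halpha hbeta cover disj.
  by rewrite [p]surjective_pairing [RHS]surjective_pairing -(belK _ LE1) -(belK _ LE2)
    H1 H2 !belK.
- move=> p pA; have [b1 b2 _ _ _] := balP _ pA; have [LE1 LE2 _ _] := gapP _ pA.
  congr (mcoeff m _); apply: (qweight_mul_eq alpha beta halpha hbeta cover disj) => //=.
  - exact: pathP.
  - exact: pathP.
  by move=> i; rewrite !pathK // balance_sum.
- by move=> p _; exact: mcoeff_qweight_mul_ge0.
Qed.
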